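(* Let $b\ge0$ and $0=x_0\le x_1\le\dots\le x_{n-1}\le x_n=b$. Let $f_j:[x_{j-1},x_j]\to\mathbb F$ be continuous for $j=1,\dots,n$, and let $c_k^j$ ($j=0,\dots,n-1$, $k=0,\dots,j$) be positive real constants with $c_0^j=1$. Then there exists a sequence of polynomials $(p_m)_{m\in\mathbb N}$ such that, for every $j=1,\dots,n$, $$\sum_{k=0}^{j-1}c_k^{j-1}p_m^{(k)}\longrightarrow f_j\quad\text{uniformly on }[x_{j-1},x_j]\text{ as }m\to\infty,$$ i.e. $p_m\to f_1$ on $[x_0,x_1]$, $p_m+c_1^1p_m'\to f_2$ on $[x_1,x_2]$, $\dots$, $p_m+c_1^{n-1}p_m'+\dots+c_{n-1}^{n-1}p_m^{(n-1)}\to f_n$ on $[x_{n-1},x_n]$.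
   Context: $\mathbb F\in\{\mathbb R,\mathbb C\}$. Intervals $[x_{j-1},x_j]$ may be degenerate (single points), in which case uniform convergence on them means convergence at that point. *)

(* Defs.v *)
(* R : realType (mathcomp-reals), F = R or F = R[i]
   (complex numbers over R, mathcomp-real-closed). Norms in F are F-valued
   (`|z| : F, real nonnegative), compared with reals embedded by emb. *)
From HB Require Import structures.
From mathcomp Require Import all_boot all_order all_algebra.
From mathcomp Require Import reals.
From mathcomp.real_closed Require Import complex.
Set Implicit Arguments. Unset Strict Implicit. Unset Printing Implicit Defensive.
Import Order.TTheory GRing.Theory Num.Theory.
Local Open Scope ring_scope.

Definition cont_on (R : realType) (F : numDomainType) (emb : R -> F)
    (a b : R) (f : R -> F) :=
  forall x, a <= x <= b -> forall eps : R, 0 < eps ->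
    exists2 delta : R, 0 < delta &
      forall y, a <= y <= b -> `|y - x| < delta -> `|f y - f x| < emb eps.

Definition unif_cvg_on (R : realType) (F : numDomainType) (emb : R -> F)
    (a b : R) (g : nat -> R -> F) (f : R -> F) :=
  forall eps : R, 0 < eps -> exists N : nat, forall m, (N <= m)%N ->
    forall t, a <= t <= b -> `|g m t - f t| < emb eps.

(* The statement for a coefficient field F into which R embeds via emb
   (used with F = R, emb = id, and F = R[i], emb = real embedding). *)
Definition poly_approx_statement (R : realType) (F : numFieldType)
    (emb : R -> F) :=
  forall (n : nat) (b : R) (x : nat -> R) (f : nat -> R -> F)
         (c : nat -> nat -> R),
    0 <= b ->
    x 0%N = 0 -> x n = b ->
    (forall j, (j < n)%N -> x j <= x j.+1) ->
    (forall j, (1 <= j <= n)%N -> cont_on emb (x j.-1) (x j) (f j)) ->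
    (forall j, (j < n)%N -> c j 0%N = 1) ->
    (forall j k, (j < n)%N -> (k <= j)%N -> 0 < c j k) ->
    exists p : nat -> {poly F},
      forall j, (1 <= j <= n)%N ->
        unif_cvg_on emb (x j.-1) (x j)
          (fun m t => \sum_(k < j) emb (c j.-1 k) * ((p m)^`(k)).[emb t])
          (f j).

(* Main.v *)
(* Real case, by induction on the number of intervals. Given a polynomial p that
   is good on the first m intervals, which fill [0, a], add r = J^m u, where J
   is the antiderivative vanishing at 0. All operators on [0, a] have order at
   most m - 1, so r is harmless there as soon as J u is small on [0, a], while
   on the next interval the condition on r is a Volterra equation of the second
   kind c_m (u - K u) = h. If v is a polynomial close to h / c_m on the next
   interval with J v small on [0, a], a partial sum of the Neumann series
   of the equation, started at v, is such a polynomial u. To obtain v, extend h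
   to [0, a] by a ramp vanishing left of a - d and apply Weierstrass' theorem:
   the jump between neighbouring f_j is absorbed in the short interval
   [a - d, a], over which the integral is small. The complex case follows by
   taking real and imaginary parts, since the coefficients are real. *)
Require Import Defs.
From HB Require Import structures.
From mathcomp Require Import all_boot all_order all_algebra.
From mathcomp Require Import reals.
From mathcomp.real_closed Require Import complex.
From mathcomp.real_closed Require Import polyrcf.
From mathcomp Require Import boolp classical_sets ring lra.
Set Implicit Arguments. Unset Strict Implicit. Unset Printing Implicit Defensive.
Import Order.TTheory GRing.Theory Num.Theory.
Local Open Scope ring_scope.

(** * Weierstrass' theorem *)

(** Continuity induction: the supremum of those [t] for which some [C] works on [[a, t]] is attained
    and equals [b]. The quadratic term is the form of uniform continuity that Chebyshev's argument
    can average. *)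
Lemma cont_on_modulus (R : realType) (a b : R) (f : R -> R) :
  a <= b -> cont_on id a b f -> forall e, 0 < e ->
  exists2 C, 0 <= C & forall x y, a <= x <= b -> a <= y <= b ->
    `|f y - f x| <= e + C * (y - x) ^+ 2.
Proof.
move=> leab cf e e0.
pose P C t := 0 <= C /\ forall x y, a <= x <= t -> a <= y <= t ->
  `|f y - f x| <= e + C * (y - x) ^+ 2.
suff [C [C0 PC]] : exists C, P C b by exists C.
pose E := [set t : R | a <= t <= b /\ exists C, P C t]%classic.
have Ea : E a.
  split; first lra.
  exists 0; split=> // x y xa ya.
  have -> : x = a by lra.
  have -> : y = a by lra.
  rewrite !subrr normr0; nra.
have supE : has_sup E by split; [exists a|exists b => t [/andP[]]].
have aS : a <= sup E by apply: sup_upper_bound.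
have Sb : sup E <= b by apply: ge_sup; [exists a|move=> t [/andP[]]].
have [d d0 dP] := cf (sup E) (introT andP (conj aS Sb)) _ (divr_gt0 e0 (ltr0n R 2)).
have [s [sab [C [C0 PC]]] ds] := sup_adherent (divr_gt0 d0 (ltr0n R 2)) supE.
have sS : s <= sup E by apply: sup_upper_bound => //; split=> //; exists C.
pose t := Num.min b (sup E + d / 2).
have tb : t <= b by rewrite /t ge_min lexx.
have tS : t <= sup E + d / 2 by rewrite /t ge_min lexx orbT.
have St : sup E <= t by rewrite /t le_min Sb /=; lra.
have st : s <= t by lra.
(* Since [s - d / 2 > sup E - d] and [t <= sup E + d / 2], both points lie within [d] of [sup E]. *)
have near x y : s - d / 2 < x <= t -> s - d / 2 < y <= t -> a <= x -> a <= y ->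
    `|f y - f x| <= e.
  move=> xs ys ax ay.
  have hx : `|f x - f (sup E)| < e / 2 by apply: dP; rewrite ?ltr_norml; lra.
  have hy : `|f y - f (sup E)| < e / 2 by apply: dP; rewrite ?ltr_norml; lra.
  move: hx hy; rewrite ltr_norml ler_norml ltr_norml; lra.
(* [M] bounds, by way of [f s], the oscillation over a pair with [x <= s - d / 2] and [s < y]. Such
   a pair is at least [d / 2] apart, so adding [M * 4 / d ^+ 2] to [C] absorbs it. *)
pose M := 2 * e + C * (b - a) ^+ 2.
have M0 : 0 <= M by have := mulr_ge0 C0 (sqr_ge0 (b - a)); rewrite /M; lra.
have sq0 (x y : R) : 0 <= (y - x) ^+ 2 by rewrite sqr_ge0.
pose D := C + M * 4 / d ^+ 2.
have D0 : 0 <= D - C.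
  by rewrite /D addrC addKr !mulr_ge0 ?invr_ge0 ?exprn_ge0 // ltW.
have wlg x y : x <= y -> a <= x <= t -> a <= y <= t ->
    `|f y - f x| <= e + D * (y - x) ^+ 2.
  move=> xy xt yt.
  have Q0 := mulr_ge0 D0 (sq0 x y).
  have Q1 := mulr_ge0 C0 (sq0 x y).
  have Q : 0 <= D * (y - x) ^+ 2 by apply: mulr_ge0 => //; lra.
  have [ys|sy] := leP y s.
    have /le_trans : `|f y - f x| <= e + C * (y - x) ^+ 2 by apply: PC; lra.
    apply; move: Q0; rewrite mulrBl; lra.
  have [xs|sx] := leP x (s - d / 2); last first.
    by apply: (@le_trans _ _ e); [apply: near; lra|lra].
  have h1 : `|f y - f s| <= e by apply: near; lra.
  have h2 : `|f s - f x| <= e + C * (s - x) ^+ 2 by apply: PC; lra.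
  have h3 : C * (s - x) ^+ 2 <= C * (b - a) ^+ 2.
    by apply: ler_wpM2l => //; rewrite lerXn2r ?nnegrE; lra.
  have h4 : M <= (D - C) * (y - x) ^+ 2.
    have -> : (D - C) * (y - x) ^+ 2 = M * ((2 * (y - x)) ^+ 2 / d ^+ 2).
      by rewrite /D; field; rewrite gt_eqF.
    rewrite ler_peMr // ler_pdivlMr ?exprn_gt0 // mul1r.
    by rewrite lerXn2r ?nnegrE; lra.
  have -> : f y - f x = (f y - f s) + (f s - f x) by ring.
  apply: (le_trans (ler_normD _ _)).
  rewrite /M in h4; rewrite mulrBl in h4; lra.
have PD : P D t.
  split=> [|x y xt yt]; first lra.
  have [xy|/ltW yx] := leP x y; first exact: wlg.
  by rewrite distrC -sqrrN opprB; apply: wlg.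
(* Now [t] belongs to [E], so [t <= sup E], which excludes [t = sup E + d / 2]. *)
exists D; suff <- : t = b by [].
apply/le_anti; rewrite tb /=.
have : t <= sup E by apply: sup_upper_bound => //; split; [lra|exists D].
rewrite {1}/t ge_min => /orP[|]; lra.
Qed.

(** De Casteljau's recursion, that is, conditioning on one Bernoulli trial: for [0 <= x <= 1] the
    value at [x] is the mean of [phi] under the binomial law with parameters [n] and [x]. *)
Fixpoint bernstein (R : nzRingType) (n : nat) (phi : nat -> R) : {poly R} :=
  if n is m.+1 then
    'X * bernstein m (fun k => phi k.+1) + (1 - 'X) * bernstein m phi
  else (phi 0%N)%:P.

Lemma horner_bernsteinS (R : comNzRingType) n (phi : nat -> R) x :
  (bernstein n.+1 phi).[x] =
  x * (bernstein n (fun k => phi k.+1)).[x] + (1 - x) * (bernstein n phi).[x].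
Proof. by rewrite /= !hornerE. Qed.

(** The first two binomial moments. All three coefficients are general because the shift of [k] in
    the recursion mixes them. *)
Lemma bernstein_quadratic (R : comNzRingType) n (u v w x : R) :
  (bernstein n (fun k => u + v * k%:R + w * k%:R ^+ 2)).[x] =
  u + v * (n%:R * x) + w * (n%:R * x * (1 - x) + (n%:R * x) ^+ 2).
Proof.
elim: n u v w => [|n IH] u v w; first by rewrite /= hornerC; ring.
rewrite horner_bernsteinS IH.
have -> : bernstein n (fun k => u + v * k.+1%:R + w * k.+1%:R ^+ 2) =
    bernstein n (fun k => (u + v + w) + (v + 2 * w) * k%:R + w * k%:R ^+ 2).
  by congr bernstein; apply: funext => k; rewrite -natr1; ring.
by rewrite IH -natr1; ring.
Qed.

Lemma bernstein_le (R : realDomainType) n (phi psi : nat -> R) x :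
  0 <= x <= 1 -> (forall k, (k <= n)%N -> phi k <= psi k) ->
  (bernstein n phi).[x] <= (bernstein n psi).[x].
Proof.
move=> x01; elim: n phi psi => [|n IH] phi psi le; first by rewrite /= !hornerC le.
rewrite !horner_bernsteinS; apply: lerD; apply: ler_wpM2l; try lra.
  by apply: IH => k kn; apply: le.
by apply: IH => k kn; apply: le; apply: leqW.
Qed.

(* Chebyshev's argument: the mean of [(k / n - x) ^+ 2] is [x * (1 - x) / n]. *)
Lemma bernstein_approx (R : realFieldType) (g : R -> R) (e C : R) n x :
  0 <= C -> (forall y z, 0 <= y <= 1 -> 0 <= z <= 1 ->
    `|g z - g y| <= e + C * (z - y) ^+ 2) ->
  0 <= x <= 1 ->
  `|(bernstein n.+1 (fun k => g (k%:R / n.+1%:R))).[x] - g x|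
    <= e + C / n.+1%:R.
Proof.
move=> C0 gP x01; set N : R := n.+1%:R.
have N0 : 0 < N by rewrite /N ltr0n.
have NV : 0 < N^-1 by rewrite invr_gt0.
have xx : 0 <= x * (1 - x) <= 1 by nra.
have bd : C * (x * (1 - x)) / N <= C / N.
  by rewrite ler_pM2r // ler_piMr //; lra.
have kP k : (k <= n.+1)%N -> `|g (k%:R / N) - g x| <= e + C * (k%:R / N - x) ^+ 2.
  move=> kn; apply: gP => //.
  by rewrite divr_ge0 ?ler0n //= ler_pdivrMr // mul1r ler_nat.
(* For [s = -1] and [s = 1] these are quadratics in [k] that enclose the node values; monotonicity
   passes the enclosure on to the polynomials. *)
have quadE s : (bernstein n.+1 (fun k => g x + s * (e + C * (k%:R / N - x) ^+ 2))).[x]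
    = g x + s * (e + C * (x * (1 - x)) / N).
  have -> : (fun k => g x + s * (e + C * (k%:R / N - x) ^+ 2)) =
      (fun k : nat => (g x + s * (e + C * x ^+ 2))
        + (- 2 * s * C * x / N) * k%:R + (s * C / N ^+ 2) * k%:R ^+ 2).
    apply: funext => k; move: N N0 {NV bd kP} => N N0.
    by field; rewrite gt_eqF.
  rewrite bernstein_quadratic -/N; move: N N0 {NV bd kP} => N N0.
  by field; rewrite gt_eqF.
have lo : g x + -1 * (e + C * (x * (1 - x)) / N) <=
    (bernstein n.+1 (fun k => g (k%:R / N))).[x].
  rewrite -quadE; apply: bernstein_le => // k /kP; rewrite ler_norml.
  by move: (_ * _ ^+ 2) => q; lra.
have hi : (bernstein n.+1 (fun k => g (k%:R / N))).[x] <=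
    g x + 1 * (e + C * (x * (1 - x)) / N).
  rewrite -quadE; apply: bernstein_le => // k /kP; rewrite ler_norml.
  by move: (_ * _ ^+ 2) => q; lra.
rewrite ler_norml; move: lo hi bd; move: (_.[x]) (C * _ / N) (C / N) => q1 q2 q3.
lra.
Qed.

Lemma weierstrass (R : realType) (B : R) (f : R -> R) :
  0 <= B ->
  (forall e, 0 < e -> exists2 C, 0 <= C & forall x y, 0 <= x <= B -> 0 <= y <= B ->
    `|f y - f x| <= e + C * (y - x) ^+ 2) ->
  forall e, 0 < e -> exists p : {poly R}, forall t, 0 <= t <= B ->
    `|p.[t] - f t| <= e.
Proof.
move=> B0 fP e e0; have [C C0 CP] := fP _ (divr_gt0 e0 (ltr0n R 2)).
pose D := C * B ^+ 2.
have D0 : 0 <= D by rewrite mulr_ge0 // exprn_ge0.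
pose n := Num.bound (2 * D / e).
pose p := bernstein n.+1 (fun k => f (B * (k%:R / n.+1%:R))).
have small : D / n.+1%:R <= e / 2.
  have N0 : 0 < n.+1%:R :> R by rewrite ltr0n.
  have : 2 * D / e < n.+1%:R.
    apply: lt_le_trans (archi_boundP _) _; last by rewrite ler_nat.
    by rewrite divr_ge0 ?mulr_ge0 // ltW.
  rewrite ltr_pdivrMr // ler_pdivrMr //; lra.
exists (p \Po (B^-1 *: 'X)) => t tB.
rewrite horner_comp hornerZ hornerX.
(* If [B = 0] then [t = 0], and the convention [0^-1 = 0] keeps the rescaling valid. *)
have Bt : B * (t / B) = t.
  have [B1|B1] := eqVneq B 0; last by rewrite mulrC divfK.
  by rewrite B1 mul0r; lra.
have tB1 : 0 <= B^-1 * t <= 1.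
  rewrite mulr_ge0 ?invr_ge0 //=; last by lra.
  have [B1|B1] := eqVneq B 0; first by rewrite B1 invr0 mul0r ler01.
  by rewrite mulrC ler_pdivrMr ?mul1r; [lra|rewrite lt_def B1].
have gP y z : 0 <= y <= 1 -> 0 <= z <= 1 ->
    `|f (B * z) - f (B * y)| <= e / 2 + D * (z - y) ^+ 2.
  move=> y01 z01; have -> : D * (z - y) ^+ 2 = C * (B * z - B * y) ^+ 2.
    by rewrite /D; ring.
  by apply: CP; nra.
apply: (@le_trans _ _ (e / 2 + D / n.+1%:R)); last by rewrite [leRHS]splitr lerD2l.
have {2}<- : B * (B^-1 * t) = t by rewrite [B^-1 * t]mulrC.
exact: (@bernstein_approx R (fun s => f (B * s))).
Qed.

(** * Antiderivatives of polynomials *)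

Definition primp (R : fieldType) (p : {poly R}) : {poly R} :=
  \poly_(i < (size p).+1) (p`_i.-1 / i%:R).

(* At [i = 0] both sides are [0] because [0^-1 = 0]. *)
Lemma coef_primp (R : fieldType) (p : {poly R}) i :
  (primp p)`_i = p`_i.-1 / i%:R.
Proof.
rewrite coef_poly; case: ltnP => // lt_p_i.
by rewrite nth_default ?mul0r // -ltnS (ltn_predK lt_p_i).
Qed.

Lemma primp_is_linear (R : fieldType) : linear (@primp R).
Proof.
move=> a p q; apply/polyP => i.
by rewrite !(coef_primp, coefD, coefZ) mulrDl mulrA.
Qed.

HB.instance Definition _ (R : fieldType) :=
  GRing.isLinear.Build R {poly R} {poly R} _ (@primp R) (@primp_is_linear R).

Lemma primp0 (R : fieldType) (p : {poly R}) : (primp p).[0] = 0.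
Proof. by rewrite horner_coef0 coef_primp invr0 mulr0. Qed.

Lemma deriv_primp (R : numFieldType) (p : {poly R}) : (primp p)^`() = p.
Proof.
apply/polyP => i; rewrite coef_deriv coef_primp /= -[_ *+ _]mulr_natr divfK //.
by rewrite pnatr_eq0.
Qed.

Lemma primpXn (R : numFieldType) i : primp 'X^i = i.+1%:R^-1 *: 'X^(i.+1) :> {poly R}.
Proof.
apply/polyP => -[|j]; rewrite coef_primp coefZ !coefXn /=.
  by rewrite invr0 !mulr0.
by rewrite eqSS mulrC; case: eqP => [->|]; rewrite ?mulr0.
Qed.

Lemma derivn_iter_primp (R : numFieldType) (u : {poly R}) m k : (k <= m)%N ->
  (iter m (@primp R) u)^`(k) = iter (m - k) (@primp R) u.
Proof.
elim: k => [|k IH] km; first by rewrite subn0.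
by rewrite derivnS IH 1?ltnW // -[(m - k)%N]prednK ?subn_gt0 // iterS deriv_primp subnS.
Qed.

Lemma poly_mean_value_le (R : rcfType) (p : {poly R}) s e M : s <= e ->
  (forall t, s < t < e -> `|p^`().[t]| <= M) -> `|p.[e] - p.[s]| <= M * (e - s).
Proof.
rewrite le_eqVlt => /predU1P[->|se] pM; first by rewrite !subrr normr0 mulr0.
have [c cse ->] := poly_mvt p se.
rewrite normrM [`|e - s|]gtr0_norm ?subr_gt0 // ler_pM2r ?subr_gt0 // pM //.
Qed.

Lemma primp_ge0 (R : rcfType) (B : R) (p : {poly R}) :
  (forall t, 0 <= t <= B -> 0 <= p.[t]) ->
  forall t, 0 <= t <= B -> 0 <= (primp p).[t].
Proof.
move=> pge0 t tB; rewrite -(primp0 p).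
apply: (@ler_hornerW R 0 B); rewrite ?in_itv /=; try lra.
by move=> x; rewrite in_itv /= deriv_primp => xB; apply: pge0; lra.
Qed.

(** The triangle inequality for integrals, from positivity applied to [q - p] and [q + p]. *)
Lemma primp_norm_le (R : rcfType) (B : R) (p q : {poly R}) :
  (forall t, 0 <= t <= B -> `|p.[t]| <= q.[t]) ->
  forall t, 0 <= t <= B -> `|(primp p).[t]| <= (primp q).[t].
Proof.
move=> pq t tB.
have := @primp_ge0 R B (q - p) _ t tB; have := @primp_ge0 R B (q + p) _ t tB.
rewrite raddfB raddfD /= !hornerE => /(_ _) h1 /(_ _) h2.
have {}h1 : 0 <= (primp q).[t] + (primp p).[t].
  by apply: h1 => s /pq; rewrite !hornerE ler_norml; lra.
have {}h2 : 0 <= (primp q).[t] - (primp p).[t].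
  by apply: h2 => s /pq; rewrite !hornerE ler_norml; lra.
by rewrite ler_norml; lra.
Qed.

Lemma poly_bounded (R : rcfType) (B : R) (p : {poly R}) :
  exists2 A, 0 <= A & forall t, 0 <= t <= B -> `|p.[t]| <= A.
Proof.
have [A pA] := poly_itv_bound p 0 B; exists `|A| => // t tB.
by rewrite (le_trans (pA t _)) ?ler_norm // in_itv.
Qed.

Lemma exp_fact_le_geometric (R : archiRealFieldType) (x : R) : 0 <= x ->
  exists2 C, 0 <= C & forall i, x ^+ i / i`!%:R <= C / 2 ^+ i.
Proof.
move=> x0; pose y := 2 * x; pose h i := y ^+ i / i`!%:R.
have h0 i : 0 <= h i by rewrite divr_ge0 ?exprn_ge0 ?mulr_ge0.
pose n := Num.bound y; exists (\sum_(i < n.+1) h i); first exact: sumr_ge0.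
move=> i; rewrite ler_pdivlMr ?exprn_gt0 // mulrAC -exprMn [x * 2]mulrC -/y -/(h i).
elim: i => [|i IH]; first by rewrite big_ord_recl lerDl sumr_ge0.
have [ni|ni] := ltnP i n.
  by rewrite (bigD1 (Ordinal (ni : i.+1 < n.+1)%N)) //= lerDl sumr_ge0.
apply: le_trans IH; rewrite /h exprSr factS mulnC natrM invfM mulrACA ler_piMr ?h0 //.
rewrite ler_pdivrMr ?ltr0n // mul1r ltW //.
apply: lt_le_trans (archi_boundP _) _; first by rewrite mulr_ge0.
by rewrite ler_nat ltnW.
Qed.

(** * Approximation with small antiderivative *)

Lemma norm_maxBr_le (R : realDomainType) (z p q : R) :
  `|Num.max z p - Num.max z q| <= `|p - q|.
Proof.
have := ler_norm (p - q); have := ler_norm (q - p); rewrite distrC.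
by case: (leP z p); case: (leP z q) => *; rewrite ler_norml; lra.
Qed.

Lemma norm_minBr_le (R : realDomainType) (z p q : R) :
  `|Num.min z p - Num.min z q| <= `|p - q|.
Proof.
have := ler_norm (p - q); have := ler_norm (q - p); rewrite distrC.
by case: (leP z p); case: (leP z q) => *; rewrite ler_norml; lra.
Qed.

(** Left of [a] only the integral of [v] has to be small, so [v] may be as large as [f a] on a short
    interval. Half of [e] pays for the ramp, of area at most [F * d], and half for the Weierstrass
    error [e1] integrated over [[0, a]]. *)
Lemma approx_with_small_primp (R : realType) (a B : R) (f : R -> R) :
  0 <= a <= B -> cont_on id a B f -> forall e, 0 < e ->
  exists v : {poly R}, (forall t, 0 <= t <= a -> `|(primp v).[t]| <= e) /\
    (forall t, a <= t <= B -> `|v.[t] - f t| <= e).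
Proof.
move=> aB cf e e0.
have leaB : a <= B by lra.
pose F := `|f a|; have F0 : 0 <= F by exact: normr_ge0.
pose d := e / (2 * (F + 1)).
have d0 : 0 < d by rewrite divr_gt0 //; lra.
have Fd : F * d <= e / 2.
  have -> : e / 2 = (F + 1) * d by rewrite /d; field; lra.
  by rewrite ler_pM2r //; lra.
pose rho t : R := Num.min 1 (Num.max 0 (1 + (t - a) / d)).
have rho01 t : 0 <= rho t <= 1.
  by rewrite /rho le_min ge_min le_max !lexx ler01.
have rho1 t : a <= t -> rho t = 1.
  move=> ta; apply/min_idPl; rewrite le_max; apply/orP; right.
  by rewrite lerDl divr_ge0 // ?subr_ge0 // ltW.
have rho0 t : t <= a - d -> rho t = 0.
  move=> ta; have h : (t - a) / d <= -1 by rewrite ler_pdivrMr //; lra.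
  have -> : rho t = Num.min 1 0 by congr Num.min; apply/max_idPl; lra.
  by apply/min_idPr; rewrite ler01.
have rho_lip x y : `|rho y - rho x| <= `|y - x| / d.
  have -> : `|y - x| / d = `|(1 + (y - a) / d) - (1 + (x - a) / d)|.
    rewrite -[d in LHS]gtr0_norm // -normfV -normrM; congr (`| _ |); ring.
  exact: le_trans (norm_minBr_le _ _ _) (norm_maxBr_le _ _ _).
(* This is [f a * rho t] left of [a] and [f t] right of it; the clamp keeps the argument of [f]
   inside [[a, B]]. *)
pose g t := f (Num.max a t) - f a + f a * rho t.
have gP e1 : 0 < e1 -> exists2 C, 0 <= C & forall x y, 0 <= x <= B -> 0 <= y <= B ->
    `|g y - g x| <= e1 + C * (y - x) ^+ 2.
  move=> e10; have [C C0 CP] := cont_on_modulus leaB cf (divr_gt0 e10 (ltr0n R 2)).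
  (* AM-GM: [L s <= e1 / 2 + (L ^+ 2 / (2 e1)) s ^+ 2] *)
  pose L := F / d; exists (C + L ^+ 2 / (2 * e1)).
    by rewrite addr_ge0 // divr_ge0 ?sqr_ge0 //; lra.
  move=> x y xB yB.
  have maxB z : 0 <= z <= B -> a <= Num.max a z <= B.
    by move=> zB; rewrite le_max lexx ge_max /=; lra.
  have h1 := CP _ _ (maxB x xB) (maxB y yB).
  have h2 : C * (Num.max a y - Num.max a x) ^+ 2 <= C * (y - x) ^+ 2.
    apply: ler_wpM2l => //; rewrite -real_normK ?num_real // -[leRHS]real_normK ?num_real //.
    by rewrite lerXn2r ?nnegrE ?normr_ge0 // norm_maxBr_le.
  have h3 : `|f a * (rho y - rho x)| <= L * `|y - x|.
    rewrite normrM -/F /L mulrAC -mulrA; exact: ler_wpM2l.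
  have h4 : L * `|y - x| <= e1 / 2 + L ^+ 2 / (2 * e1) * (y - x) ^+ 2.
    rewrite -[(y - x) ^+ 2]real_normK ?num_real //; move: `|y - x| => s.
    have -> : e1 / 2 + L ^+ 2 / (2 * e1) * s ^+ 2 =
      L * s + (e1 - L * s) ^+ 2 / (2 * e1) by field; lra.
    by rewrite lerDl divr_ge0 ?sqr_ge0 //; lra.
  have -> : g y - g x = (f (Num.max a y) - f (Num.max a x)) + f a * (rho y - rho x).
    by rewrite /g; ring.
  apply: le_trans (ler_normD _ _) _; rewrite mulrDl.
  move: h1 h2 h3 h4; move: (C * _) (C * _) (_ / _ * _) => *; lra.
pose e1 := e / (2 * (B + 1)).
have B0 : 0 <= B by lra.
have e10 : 0 < e1 by rewrite divr_gt0 //; lra.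
have e1B : e1 * B + e1 = e / 2 by rewrite /e1; field; lra.
have e1B0 : 0 <= e1 * B by rewrite mulr_ge0 // ltW.
have [v vP] := weierstrass B0 gP e10.
exists v; split=> t ta; last first.
  have : 0 <= t <= B by lra.
  move/vP; rewrite /g (max_idPr _) ?rho1; try lra.
  by move/le_trans; rewrite mulr1 subrK; apply; lra.
(* The ramp vanishes on [[0, m]]; the maximum covers the case where it would start left of [0]. *)
pose m := Num.max 0 (a - d).
have m0 : 0 <= m by rewrite /m le_max lexx.
have ma : m <= a by rewrite /m ge_max; lra.
have amd : a - m <= d by have : a - d <= m by [rewrite /m le_max lexx orbT]; lra.
have vle s : 0 <= s <= a -> `|v.[s]| <= e1 + F * rho s.
  move=> sa; have sB : 0 <= s <= B by lra.
  have := vP _ sB; rewrite /g (max_idPl _); last by lra.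
  rewrite subrr add0r -{2}(ger0_norm (proj1 (andP (rho01 s)))) -normrM => h.
  rewrite -[v.[s]](subrK (f a * rho s)); apply: le_trans (ler_normD _ _) _; lra.
have left s : 0 <= s <= m -> `|(primp v).[s]| <= e1 * s.
  move=> sm; have := @poly_mean_value_le R (primp v) 0 s e1.
  rewrite primp0 !subr0; apply; first lra.
  move=> r rs; rewrite deriv_primp.
  have ra : r <= a - d.
    have : r < m by lra.
    by rewrite /m lt_max; lra.
  by have := vle r; rewrite rho0 // mulr0 addr0; apply; lra.
have [tm|mt] := leP t m.
  apply: le_trans (left t _) _; first lra.
  have : e1 * t <= e1 * B by rewrite ler_pM2l //; lra.
  lra.
have h1 : `|(primp v).[m]| <= e1 * m by apply: left; lra.
have h2 : `|(primp v).[t] - (primp v).[m]| <= (e1 + F) * (t - m).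
  apply: poly_mean_value_le; first by lra.
  move=> r rt; rewrite deriv_primp; apply: le_trans (vle r _) _; first lra.
  by rewrite lerD2l ler_piMr //; case/andP: (rho01 r).
rewrite -[(primp v).[t]](subrK (primp v).[m]); apply: le_trans (ler_normD _ _) _.
have h3 : F * (t - m) <= F * d by apply: ler_wpM2l => //; lra.
have h4 : e1 * t <= e1 * B by rewrite ler_pM2l //; lra.
rewrite mulrDl !mulrBr in h2 h3 *; lra.
Qed.

(** * Volterra equations *)

Definition volterra (R : fieldType) m (a : nat -> R) (v : {poly R}) : {poly R} :=
  - \sum_(k < m) a k *: iter k.+1 (@primp R) v.

Lemma volterra_is_linear (R : fieldType) m (a : nat -> R) : linear (volterra m a).
Proof.
have iterP k : linear (iter k (@primp R)).
  by elim: k => [|k IH] // x p q; rewrite !iterS IH linearP.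
move=> x p q; rewrite /volterra scalerN -opprD scaler_sumr -big_split /=.
congr (- _); apply: eq_bigr => k _.
by rewrite (iterP k) linearP scalerDr !scalerA mulrC.
Qed.

HB.instance Definition _ (R : fieldType) m (a : nat -> R) :=
  GRing.isLinear.Build R {poly R} {poly R} _ (volterra m a) (volterra_is_linear m a).

(** The operator is a polynomial in [primp]. This transfers the Neumann series of [v] to that of
    [primp v], hence bounds on [primp v] to [primp u]. *)
Lemma primp_volterra (R : fieldType) m (a : nat -> R) v :
  primp (volterra m a v) = volterra m a (primp v).
Proof.
rewrite /volterra raddfN raddf_sum; congr (- _); apply: eq_bigr => k _.
by rewrite /= linearZ -iterSr.
Qed.

(** The majorant is the [i]-fold antiderivative of the constant [A], so each integration raises [i]
    by one. *)
Definition taylor_bounded (R : numFieldType) (b : R) (v : {poly R}) i (A : R) :=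
  forall t, 0 <= t <= b -> `|v.[t]| <= A * (t ^+ i / i`!%:R).

Lemma taylor_bounded_primp (R : rcfType) (b : R) v i A :
  taylor_bounded b v i A -> taylor_bounded b (primp v) i.+1 A.
Proof.
move=> vb t tb; have vq s : 0 <= s <= b -> `|v.[s]| <= ((A / i`!%:R) *: 'X^i).[s].
  by move/vb; rewrite hornerZ hornerXn [A / _ * _]mulrAC mulrA.
apply: le_trans (primp_norm_le vq tb) _.
rewrite linearZ /= primpXn scalerA hornerZ hornerXn factS natrM invfM.
by rewrite [_^-1 / _]mulrC [_ ^+ _ * _]mulrC !mulrA.
Qed.

Lemma taylor_boundedW (R : rcfType) (b B : R) v i A : 0 <= A -> b <= B ->
  taylor_bounded b v i.+1 A -> taylor_bounded b v i (A * B).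
Proof.
move=> A0 bB vb t tb; apply: le_trans (vb t tb) _; rewrite -mulrA ler_wpM2l //.
have Hi : 0 <= t ^+ i / i`!%:R by rewrite divr_ge0 ?exprn_ge0 //; lra.
rewrite exprS factS natrM invfM mulrACA.
apply: ler_pM => //; first by rewrite divr_ge0 //; lra.
by rewrite ler_pdivrMr ?ltr0n // (le_trans _ (_ : B <= _)) ?ler_peMr ?ler1n //; lra.
Qed.

(** Only one of the [k.+1] integrations is kept as a gain in degree; each other one is weakened to a
    factor [B], so that all terms of the Volterra operator gain the same degree. *)
Lemma taylor_bounded_iter_primp (R : rcfType) (b B : R) v i A k :
  0 <= A -> 0 <= b <= B ->
  taylor_bounded b v i A ->
  taylor_bounded b (iter k.+1 (@primp R) v) i.+1 (A * B ^+ k).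
Proof.
move=> A0 bB vb; elim: k => [|k IH].
  by rewrite mulr1; exact: taylor_bounded_primp.
rewrite exprSr mulrA iterS; apply: taylor_boundedW; last exact: taylor_bounded_primp.
  by rewrite mulr_ge0 // exprn_ge0 //; lra.
by lra.
Qed.

Lemma taylor_bounded_volterra (R : rcfType) m (a : nat -> R) (b B : R) v i A :
  0 <= A -> 0 <= b <= B ->
  taylor_bounded b v i A ->
  taylor_bounded b (volterra m a v) i.+1 ((\sum_(k < m) `|a k| * B ^+ k) * A).
Proof.
move=> A0 bB vb t tb; rewrite /volterra hornerN normrN horner_sum.
apply: le_trans (ler_norm_sum _ _ _) _; rewrite !mulr_suml; apply: ler_sum => k _.
rewrite hornerZ normrM -!mulrA ler_wpM2l //.
by rewrite [leRHS]mulrCA mulrA; apply: taylor_bounded_iter_primp tb.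
Qed.

Lemma taylor_bounded_iter_volterra (R : rcfType) m (a : nat -> R) (b B : R) v A n :
  0 <= A -> 0 <= b <= B -> taylor_bounded b v 0 A ->
  taylor_bounded b (iter n (volterra m a) v) n ((\sum_(k < m) `|a k| * B ^+ k) ^+ n * A).
Proof.
move=> A0 bB vb; elim: n => [|n IH]; first by rewrite mul1r.
rewrite exprS -mulrA iterS; apply: taylor_bounded_volterra => //.
rewrite mulr_ge0 // exprn_ge0 // sumr_ge0 // => k _.
by rewrite mulr_ge0 // exprn_ge0 //; lra.
Qed.

Lemma sum_half_pow_le (R : realFieldType) n : \sum_(i < n) (2 ^+ i)^-1 <= 2 :> R.
Proof.
suff -> : \sum_(i < n) (2 ^+ i)^-1 = 2 - 2 / 2 ^+ n :> R.
  by rewrite lerBlDr lerDl divr_ge0 ?exprn_ge0.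
elim: n => [|n IH]; first by rewrite big_ord0 divr1 subrr.
by rewrite big_ord_recr /= IH exprS; field; rewrite ?expf_neq0 ?pnatr_eq0 //.
Qed.

Lemma neumann_telescope (V : zmodType) (K : {additive V -> V}) v n :
  \sum_(i < n) iter i K v - K (\sum_(i < n) iter i K v) = v - iter n K v.
Proof.
elim: n => [|n IH]; first by rewrite !big_ord0 raddf0 !subrr.
by rewrite !big_ord_recr raddfD opprD addrACA IH addrA subrK iterS.
Qed.

(* [u] is a partial sum of the Neumann series [\sum_i K ^ i v], with [K] the
   Volterra operator; the iterated integrals make its terms decay factorially. *)
Lemma volterra_approx_solution (R : realType) m (a : nat -> R) (B : R) : 0 <= B ->
  exists2 C, 0 <= C & forall (v : {poly R}) e, 0 < e -> exists u : {poly R},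
    (forall t, 0 <= t <= B -> `|(u - volterra m a u - v).[t]| <= e) /\
    (forall b E, 0 <= b <= B -> (forall t, 0 <= t <= b -> `|(primp v).[t]| <= E) ->
      forall t, 0 <= t <= b -> `|(primp u).[t]| <= C * E).
Proof.
move=> B0; pose M := \sum_(k < m) `|a k| * B ^+ k.
have M0 : 0 <= M by apply: sumr_ge0 => k _; rewrite mulr_ge0 // exprn_ge0.
have [C C0 CP] := exp_fact_le_geometric (mulr_ge0 M0 B0).
have decay v b A n : 0 <= b <= B -> 0 <= A ->
    (forall t, 0 <= t <= b -> `|v.[t]| <= A) ->
    forall t, 0 <= t <= b -> `|(iter n (volterra m a) v).[t]| <= A * (C / 2 ^+ n).
  move=> bB A0 vA t tb.
  have vb : taylor_bounded b v 0 A by move=> s /vA; rewrite divr1 mulr1.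
  apply: le_trans (taylor_bounded_iter_volterra m a n A0 bB vb tb) _.
  rewrite [_ * A]mulrC -mulrA ler_wpM2l // -/M mulrA -exprMn.
  apply: le_trans _ (CP n); rewrite ler_wpM2r ?invr_ge0 //.
  by rewrite lerXn2r ?nnegrE ?mulr_ge0 ?ler_wpM2l //; lra.
(* The factor [2] sums the geometric series. The constant must not depend on [v] or [e], although
   the number of terms does. *)
exists (C * 2) => [|v e e0]; first by rewrite mulr_ge0.
have [A A0 vA] := poly_bounded B v.
pose n := Num.bound (A * C / e).
have small : A * (C / 2 ^+ n) <= e.
  rewrite mulrA ler_pdivrMr ?exprn_gt0 // [e * _]mulrC -ler_pdivrMr //.
  apply: (@le_trans _ _ n%:R); last by rewrite -natrX ler_nat ltnW // ltn_expl.
  by rewrite ltW // archi_boundP // divr_ge0 ?mulr_ge0 // ltW.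
pose u := \sum_(i < n) iter i (volterra m a) v.
exists u; split.
  have -> : u - volterra m a u - v = - iter n (volterra m a) v.
    by rewrite neumann_telescope addrAC subrr sub0r.
  move=> t tB; rewrite hornerN normrN; apply: le_trans _ small.
  by apply: decay tB => //; rewrite B0 lexx.
move=> b E bB vE t tb.
have E0 : 0 <= E by apply: le_trans (vE _ tb).
have -> : primp u = \sum_(i < n) iter i (volterra m a) (primp v).
  rewrite /u raddf_sum /=; apply: eq_bigr => i _.
  by elim: (i : nat) => [|j IH] //=; rewrite primp_volterra IH.
rewrite horner_sum; apply: le_trans (ler_norm_sum _ _ _) _.
apply: (@le_trans _ _ (\sum_(i < n) E * C * (2 ^+ i)^-1)).
  by apply: ler_sum => i _; rewrite -mulrA; apply: decay tb.
by rewrite -mulr_sumr [leRHS]mulrAC [C * E]mulrC ler_wpM2l ?mulr_ge0 // sum_half_pow_le.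
Qed.

(** * The approximation theorem *)

(** Each integration costs a factor at most [B]; [1 + B] makes the powers monotone in [j], giving
    one bound for all orders. *)
Lemma iter_primp_le (R : rcfType) (B E : R) (w : {poly R}) j b : 0 <= b <= B ->
  (forall t, 0 <= t <= b -> `|w.[t]| <= E) ->
  forall t, 0 <= t <= b -> `|(iter j (@primp R) w).[t]| <= E * (1 + B) ^+ j.
Proof.
move=> bB wE; elim: j => [|j IH] t tb; first by rewrite mulr1 wE.
have := @poly_mean_value_le R (iter j.+1 (@primp R) w) 0 t (E * (1 + B) ^+ j).
rewrite iterS deriv_primp primp0 !subr0 => /(_ _ _)/le_trans; apply.
- by lra.
- by move=> s st; apply: IH; lra.
rewrite exprSr mulrA ler_wpM2l //; last by lra.
by apply: le_trans (IH t tb).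
Qed.

(* [r = J^m u] with [J] the antiderivative vanishing at [0]: the equation for
   [r] is a Volterra equation for [u], and smallness of [r^`(k)], [k < m], on
   [0, a] only requires [J u] to be small there. *)
Lemma correction_poly (R : realType) m (c : nat -> R) (a B : R) (h : R -> R) :
  0 <= a <= B -> 0 < c m -> cont_on id a B h -> forall e, 0 < e ->
  exists r : {poly R},
    (forall k t, (k < m)%N -> 0 <= t <= a -> `|r^`(k).[t]| <= e) /\
    (forall t, a <= t <= B -> `|\sum_(k < m.+1) c k * r^`(k).[t] - h t| <= e).
Proof.
move=> aB cm0 ch e e0.
have B0 : 0 <= B by lra.
(* With [r = J^m u], the derivative of order [m - k.+1] is [J^(k.+1) u], whence the reversed
   coefficients. *)
have [C C0 CP] := volterra_approx_solution m (fun k => c (m - k.+1)%N / c m) B0.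
pose D := (C + 1) * (1 + B) ^+ m.
have D0 : 0 < D by rewrite mulr_gt0 ?exprn_gt0 //; lra.
pose E := e / D.
have E0 : 0 < E by rewrite divr_gt0.
(* The first bound makes [J (w / c m)] at most [E] on [[0, a]]; the second leaves [e / 2] for the
   Volterra residual, which gets multiplied by [c m]. *)
pose e1 := Num.min (c m * E) (e / 2).
have e10 : 0 < e1 by rewrite /e1 lt_min mulr_gt0 //=; lra.
have e1E : e1 <= c m * E by rewrite /e1 ge_min lexx.
have e1e : e1 <= e / 2 by rewrite /e1 ge_min lexx orbT.
have [w [wE wh]] := approx_with_small_primp aB ch e10.
have e20 : 0 < e / 2 / c m by rewrite divr_gt0 //; lra.
have [u [uw uE]] := CP ((c m)^-1 *: w) _ e20.
have u_small t : 0 <= t <= a -> `|(primp u).[t]| <= C * E.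
  apply: uE => // s sa; rewrite linearZ hornerZ normrM gtr0_norm ?invr_gt0 //.
  by rewrite mulrC ler_pdivrMr // mulrC (le_trans (wE s sa)).
pose r := iter m (@primp R) u; exists r; split=> [k t km ta|t ta].
  (* As [k < m], at least one integration remains, and the others act on [primp u]. *)
  rewrite derivn_iter_primp ?(ltnW km) // -[(m - k)%N]prednK ?subn_gt0 // iterSr.
  apply: le_trans (iter_primp_le _ aB u_small ta) _.
  have -> : e = E * D by rewrite /E divfK // gt_eqF.
  rewrite mulrAC mulrC ler_wpM2l //; first exact: ltW.
  apply: ler_pM => //; [by rewrite exprn_ge0 //; lra|by lra|].
  by rewrite ler_weXn2l //; [lra|rewrite (leq_trans (leq_pred _)) ?leq_subr].
have -> : \sum_(k < m.+1) c k * r^`(k).[t] =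
    c m * (u - volterra m (fun k => c (m - k.+1)%N / c m) u).[t].
  rewrite big_ord_recr /= derivn_iter_primp // subnn /= /volterra opprK hornerD.
  rewrite mulrDr addrC; congr (_ + _).
  rewrite horner_sum mulr_sumr (reindex_inj rev_ord_inj) /=.
  apply: eq_bigr => k _; rewrite derivn_iter_primp ?leq_subr // subKn //.
  by rewrite hornerZ mulrA mulrCA divff ?mulr1 // gt_eqF.
have tB : 0 <= t <= B by lra.
have := uw t tB; set z := u - _; rewrite hornerD hornerN hornerZ => h1.
have h2 : `|c m * (z.[t] - (c m)^-1 * w.[t])| <= e / 2.
  by rewrite normrM gtr0_norm // mulrC -ler_pdivlMr.
have := wh t ta; move: h2; rewrite mulrBr mulVKf ?gt_eqF // => h2 h3.
have -> : c m * z.[t] - h t = (c m * z.[t] - w.[t]) + (w.[t] - h t) by ring.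
by apply: le_trans (ler_normD _ _) _; lra.
Qed.

Lemma cont_on_sub_poly (R : realType) (a b : R) (f : R -> R) (p : {poly R}) :
  cont_on id a b f -> cont_on id a b (fun t => f t - p.[t]).
Proof.
move=> cf x xab e e0; have e20 : 0 < e / 2 by lra.
have [d d0 dP] := cf x xab _ e20; have [d' d'0 d'P] := poly_cont x p e20.
exists (Num.min d d') => [|y yab]; first by rewrite lt_min d0.
rewrite lt_min => /andP[/(dP y yab) h1 /d'P h2].
have -> : f y - p.[y] - (f x - p.[x]) = (f y - f x) - (p.[y] - p.[x]) by ring.
by apply: le_lt_trans (ler_normB _ _) _; move: h1 => /=; lra.
Qed.

(** Choice along the tolerances [m.+1%:R^-1] reduces the sequence to one polynomial per
    tolerance. *)
Lemma unif_cvg_of_approx (R : realType) (n : nat) (x : nat -> R)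
    (f : nat -> R -> R) (c : nat -> nat -> R) :
  (forall e, 0 < e -> exists p : {poly R}, forall j t, (1 <= j <= n)%N ->
    x j.-1 <= t <= x j -> `|\sum_(k < j) c j.-1 k * p^`(k).[t] - f j t| <= e) ->
  exists p : nat -> {poly R}, forall j, (1 <= j <= n)%N ->
    unif_cvg_on id (x j.-1) (x j)
      (fun m t => \sum_(k < j) c j.-1 k * (p m)^`(k).[t]) (f j).
Proof.
move=> H; have /choice[p pP] : forall m : nat, exists p : {poly R},
    forall j t, (1 <= j <= n)%N -> x j.-1 <= t <= x j ->
      `|\sum_(k < j) c j.-1 k * p^`(k).[t] - f j t| <= m.+1%:R^-1.
  by move=> m; apply: H; rewrite invr_gt0.
exists p => j jn e e0; exists (Num.bound e^-1) => m lem t tx.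
apply: le_lt_trans (pP m j t jn tx) _.
rewrite -[ltRHS]invrK ltf_pV2 ?posrE ?invr_gt0 //.
apply: lt_le_trans (archi_boundP _) _; first by rewrite invr_ge0 ltW.
by rewrite ler_nat (leq_trans lem).
Qed.

Lemma poly_approx_real (R : realType) :
  poly_approx_statement (R := R) (F := R) id.
Proof.
move=> n b x f c b0 x0 xn xle cf c1 c0; apply: unif_cvg_of_approx.
have x_homo i j : (i <= j <= n)%N -> x i <= x j.
  elim: j => [|j IH] /andP[]; first by rewrite leqn0 => /eqP->.
  rewrite leq_eqVlt => /predU1P[->//|ij] jn.
  by apply: le_trans (xle j jn); apply: IH; apply/andP; split; [|apply: ltnW].
suff H m : (m <= n)%N -> forall e, 0 < e -> exists p : {poly R}, forall j t,
    (1 <= j <= m)%N -> x j.-1 <= t <= x j ->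
    `|\sum_(k < j) c j.-1 k * p^`(k).[t] - f j t| <= e by apply: H.
elim: m => [|m IH] mn e e0.
  by exists 0 => j t /andP[j0]; rewrite leqn0 => /eqP jE; rewrite jE in j0.
have [p pP] := IH (ltnW mn) (e / 2) (divr_gt0 e0 (ltr0n R 2)).
(* What [p] still misses on the next interval is the target for the correction. *)
pose h t := f m.+1 t - (\sum_(k < m.+1) c m k *: p^`(k)).[t].
have ch : cont_on id (x m) (x m.+1) h.
  by apply: cont_on_sub_poly; apply: (cf m.+1); rewrite ltnS.
have xm : 0 <= x m <= x m.+1 by rewrite xle // andbT -x0 x_homo // leq0n ltnW.
(* [S] dominates the absolute coefficient sum of every row, so a correction with derivatives at most
   [e1] changes each earlier expression by at most [S * e1], which is below [e / 2]. *)
pose S := \sum_(j < n) \sum_(k < n) `|c j k|.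
have S0 : 0 <= S by apply: sumr_ge0 => j _; apply: sumr_ge0 => k _.
pose e1 := e / 2 / (S + 1).
have e10 : 0 < e1 by rewrite !divr_gt0 //; lra.
have Se1 : S * e1 + e1 = e / 2 by rewrite /e1; field; lra.
have Se10 : 0 <= S * e1 by rewrite mulr_ge0 // ltW.
have [r [r_small r_approx]] := correction_poly xm (c0 m m mn (leqnn m)) ch e10.
have sumD j t : \sum_(k < j) c j.-1 k * (p + r)^`(k).[t] =
    \sum_(k < j) c j.-1 k * p^`(k).[t] + \sum_(k < j) c j.-1 k * r^`(k).[t].
  by rewrite -big_split /=; apply: eq_bigr => k _; rewrite derivnD hornerD mulrDr.
exists (p + r) => j t /andP[j0 jm] tx; rewrite sumD.
move: jm; rewrite leq_eqVlt => /predU1P[jE|jm].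
  move: tx; rewrite jE /= => /r_approx; rewrite /h horner_sum.
  have -> : \sum_(k < m.+1) (c m k *: p^`(k)).[t] = \sum_(k < m.+1) c m k * p^`(k).[t].
    by apply: eq_bigr => k _; rewrite hornerZ.
  set u := \sum_(k < _) _; set v := \sum_(k < _) _.
  have -> : u - (f m.+1 t - v) = v + u - f m.+1 t by ring.
  by move/le_trans; apply; lra.
rewrite ltnS in jm; have jn : (j <= n)%N by apply: leq_trans jm (ltnW mn).
have h1 := pP j t (introT andP (conj j0 jm)) tx.
have ta : 0 <= t <= x m.
  have := x_homo 0%N j.-1; have := x_homo j m.
  rewrite jm (ltnW mn) (leq_trans (leq_pred _) jn) x0 => /(_ isT) ? /(_ isT) ?.
  by lra.
have h2 : `|\sum_(k < j) c j.-1 k * r^`(k).[t]| <= S * e1.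
  apply: (@le_trans _ _ ((\sum_(k < j) `|c j.-1 k|) * e1)).
    rewrite mulr_suml; apply: le_trans (ler_norm_sum _ _ _) _; apply: ler_sum => k _.
    by rewrite normrM ler_wpM2l // r_small // (leq_trans (ltn_ord k)).
  have jn' : (j.-1 < n)%N by rewrite prednK.
  rewrite ler_wpM2r ?(ltW e10) // /S (bigD1 (Ordinal jn')) //=.
  apply: (@le_trans _ _ (\sum_(k < n) `|c j.-1 k|)); last first.
    by rewrite lerDl; do 2 (apply: sumr_ge0 => ? _).
  rewrite -(big_mkord xpredT (fun k => `|c j.-1 k|)).
  rewrite -(big_mkord xpredT (fun k => `|c j.-1 k|)).
  by rewrite (big_cat_nat _ jn) //= lerDl; apply: sumr_ge0.
rewrite addrAC; apply: le_trans (ler_normD _ _) _; lra.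
Qed.

(** * Complex coefficients *)

Lemma normc_ltP (R : rcfType) (z : R[i]) (e : R) : 0 < e ->
  `|complex.Re z| < e / 2 -> `|complex.Im z| < e / 2 -> `|z| < (e%:C)%C.
Proof.
move=> e0 h1 h2; rewrite normc_def ltcR -(ger0_norm (ltW e0)) -sqrtr_sqr.
rewrite ltr_sqrt ?exprn_gt0 //.
have h (y : R) : `|y| < e / 2 -> y ^+ 2 < e ^+ 2 / 2.
  move=> hy; apply: (@le_lt_trans _ _ ((e / 2) ^+ 2)).
    by rewrite -real_normK ?num_real // lerXn2r ?nnegrE //; lra.
  have := exprn_gt0 2 e0; rewrite expr_div_n; lra.
by move: (h _ h1) (h _ h2); lra.
Qed.

Lemma normc_ltW (R : rcfType) (z : R[i]) (e : R) : `|z| < (e%:C)%C ->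
  `|complex.Re z| < e /\ `|complex.Im z| < e.
Proof.
rewrite normc_def ltcR => h; rewrite -!sqrtr_sqr.
by split; apply: le_lt_trans h; apply: ler_wsqrtr; rewrite ?lerDl ?lerDr sqr_ge0.
Qed.

Lemma poly_approx_complex (R : realType) :
  poly_approx_statement (R := R) (F := R[i]) (fun r : R => (r%:C)%C).
Proof.
move=> n b x f c b0 x0 xn xle cf c1 c0.
(* Stated for an abstract [g] so that the real theorem serves both the real and the imaginary parts
   of the [f j]. *)
have part (g : R[i] -> R) :
    (forall z w, g (z - w) = g z - g w) ->
    (forall z e, `|z| < (e%:C)%C -> `|g z| < e) ->
    exists p : nat -> {poly R}, forall j, (1 <= j <= n)%N ->
      unif_cvg_on id (x j.-1) (x j)
        (fun m t => \sum_(k < j) c j.-1 k * (p m)^`(k).[t]) (fun t => g (f j t)).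
  move=> gB g_lt; apply: (poly_approx_real b0 x0 xn xle) => // j jn t tx e e0.
  have [d d0 dP] := cf j jn t tx e e0; exists d => // y yx yt.
  by rewrite -gB; apply: g_lt; apply: dP.
have [p pP] := part (@complex.Re R) (fun z w => raddfB _ z w)
  (fun z e h => proj1 (normc_ltW h)).
have [q qP] := part (@complex.Im R) (fun z w => raddfB _ z w)
  (fun z e h => proj2 (normc_ltW h)).
exists (fun m => map_poly (real_complex R) (p m) + 'i%C *: map_poly (real_complex R) (q m)) => j jn e e0.
have [N1 N1P] := pP j jn (e / 2) (divr_gt0 e0 (ltr0n R 2)).
have [N2 N2P] := qP j jn (e / 2) (divr_gt0 e0 (ltr0n R 2)).
exists (maxn N1 N2) => m; rewrite geq_max => /andP[m1 m2] t tx.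
have := N1P m m1 t tx; have := N2P m m2 t tx.
set u := \sum_(k < j) _; set v := \sum_(k < j) _ => hu hv.
(* Derivatives commute with the embedding of coefficients and the [c j k] are real, so the
   expression splits into the ones for [p] and [q]. *)
have -> : \sum_(k < j) ((c j.-1 k)%:C)%C *
    (map_poly (real_complex R) (p m) + 'i%C *: map_poly (real_complex R) (q m))^`(k).[(t%:C)%C] = (v%:C)%C + 'i%C * (u%:C)%C.
  rewrite !rmorph_sum mulr_sumr -big_split /=; apply: eq_bigr => k _.
  rewrite derivnD derivnZ !derivn_map hornerD hornerZ !horner_map !rmorphM.
  by rewrite mulrDr mulrCA.
by apply: normc_ltP; rewrite // ?raddfB ?raddfD /= ?mul0r ?mul1r ?mulr0 ?subr0
  ?addr0 ?add0r ?sub0r ?oppr0.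
Qed.

Theorem mainTheorem14 (R : realType) :
  poly_approx_statement (R := R) (F := R) id /\
  poly_approx_statement (R := R) (F := R[i]) (fun r : R => (r%:C)%C).
Proof. by split; [exact: poly_approx_real|exact: poly_approx_complex]. Qed.
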